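(* Suppose that $\mathcal{L}_S$ (as an operator on $L^1(m)$) is asymptotically periodic, with data $\widehat{s}$, $\widehat{r}(i)$, $\widehat{g}_{i,j}$, $\widehat{\lambda}_{i,j}$ ($1\le i\le\widehat{s}$, $1\le j\le\widehat{r}(i)$), and that $\eta(\{y\in Y;\ T_y=I_d\})>0$, where $I_d$ is the identity map on $X$. Then $\widehat{r}(i)=1$ for every $i\in\{1,2,\dots,\widehat{s}\}$.
   Context: Let $(X,\mathcal{F},m)$ be a probability space. A measurable map $T:X\to X$ is $m$-nonsingular if $m(T^{-1}(A))=0$ whenever $A\in\mathcal{F}$, $m(A)=0$. For such $T$ the Perron--Frobenius operator $\mathcal{L}_T$ on $L^1(m)$ is $\mathcal{L}_Tf=\frac{dm_f}{dm}$, where $m_f(A)=\int_{T^{-1}(A)}f\,dm$. Let $Y$ be a complete separable metric space with Borel field $\mathcal{B}(Y)$ and a probability measure $\eta$ on it; let $\Omega=\prod_{i=1}^\infty Y$ with its Borel field $\mathcal{B}(\Omega)$ and the product measure $P=\prod_{i=1}^\infty\eta$. Let $(T_y)_{y\in Y}$ be a family of $m$-nonsingular transformations of $X$ such that $(x,y)\mapsto T_yx$ is measurable. The skew product $S:X\times\Omega\to X\times\Omega$ is $S(x,\omega)=(T_{\omega_1}x,\sigma\omega)$, where $\omega=(\omega_i)_{i\ge1}$ and $\sigma((\omega_i)_{i\ge 1})=(\omega_{i+1})_{i\ge 1}$. It is nonsingular for $m\times P$ and its Perron--Frobenius operator $\mathcal{L}_S$ on $L^1(m\times P)$ is defined by $\iint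 h\,\mathcal{L}_Sf\,dm\,dP=\iint f\,(h\circ S)\,dm\,dP$ for $h\in L^\infty(m\times P)$. For $f\in L^1(m)$ (viewed as a function of $(x,\omega)$ not depending on $\omega$), $(\mathcal{L}_Sf)(x,\omega)=\int_Y(\mathcal{L}_{T_y}f)(x)\,\eta(dy)$ a.e., so $\mathcal{L}_S$ maps $L^1(m)$ to itself and is regarded as an operator on $L^1(m)$. Asymptotic periodicity of $\mathcal{L}_S$ means: there exist positive integers $\widehat{s}$ and $\widehat{r}(i)$ ($1\le i\le\widehat{s}$), probability density functions $\widehat{g}_{i,j}\in L^1(m)$, and bounded linear functionals $\widehat{\lambda}_{i,j}$ on $L^1(m)$ ($1\le i\le\widehat{s}$, $1\le j\le\widehat{r}(i)$) such that: (i) $\widehat{g}_{i,j}\cdot\widehat{g}_{k,l}=0$ for all $(i,j)\ne(k,l)$; (ii) $\mathcal{L}_S\widehat{g}_{i,j}=\widehat{g}_{i,j+1}$ for $1\le j\le\widehat{r}(i)-1$ and $\mathcal{L}_S\widehat{g}_{i,\widehat{r}(i)}=\widehat{g}_{i,1}$, for all $i$; (iii) $\lim_{n\to\infty}\big\|(\mathcal{L}_S)^n\big(f-\sum_{i=1}^{\widehat{s}}\sum_{j=1}^{\widehat{r}(i)}\widehat{\lambda}_{i,j}(f)\widehat{g}_{i,j}\big)\big\|_{L^1(m)}=0$ for every $f\in L^1(m)$. *)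

(* Defs.v *)
From HB Require Import structures.
From mathcomp Require Import all_boot all_order all_algebra.
From mathcomp Require Import all_classical all_reals all_analysis.

Set Implicit Arguments.
Unset Strict Implicit.
Unset Printing Implicit Defensive.

Import Order.TTheory GRing.Theory Num.Theory.
Import numFieldTopology.Exports.

Local Open Scope classical_set_scope.
Local Open Scope ring_scope.

#[short(type="completeMetricType")]
HB.structure Definition CompleteMetric (K : numDomainType) :=
  {T of Complete T & Metric K T}.

Definition separable (T : topologicalType) : Prop :=
  exists2 D : set T, countable D & dense D.

Definition borel (T : ptopologicalType) := g_sigma_algebraType (@open T).
HB.instance Definition _ (T : ptopologicalType) := Measurable.on (borel T).
HB.instance Definition _ (T : ptopologicalType) := Pointed.on (borel T).

(* The one-sided sequence space with the product topology.  Coordinates are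
   numbered from 0: [w n] is the coordinate written omega_(n+1) when counting
   starts at 1. *)
Definition seq_space (Y : ptopologicalType) := {ptws nat -> Y}.
HB.instance Definition _ (Y : ptopologicalType) :=
  Topological.copy (seq_space Y) {ptws nat -> Y}.
HB.instance Definition _ (Y : ptopologicalType) :=
  Pointed.copy (seq_space Y) (nat -> Y).

(* The finite-dimensional marginals determine P when Y is separable
   and metric: cylinders then generate the Borel field of [seq_space Y]. *)
Definition is_product_measure (R : realType) (Y : ptopologicalType)
    (eta : probability (borel Y) R)
    (P : probability (borel (seq_space Y)) R) : Prop :=
  forall (n : nat) (A : nat -> set (borel Y)),
    (forall i, measurable (A i)) ->
    P [set w : borel (seq_space Y) | forall i, (i < n)%N -> A i (w i)] =
    (\prod_(i < n) eta (A i))%E.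

Definition nonsingular (d : measure_display) (R : realType)
    (X : measurableType d) (mu : {measure set X -> \bar R}) (T : X -> X)
    : Prop :=
  measurable_fun setT T /\
  forall A, measurable A -> mu A = 0%E -> mu (T @^-1` A) = 0%E.

Definition skew_product (X : Type) (Y : ptopologicalType) (T : Y -> X -> X)
    (z : X * borel (seq_space Y)) : X * borel (seq_space Y) :=
  (T (z.2 0%N) z.1, fun n => z.2 n.+1).

Section perron_frobenius.
Context (d : measure_display) (R : realType) (Z : measurableType d).
Variables (mu : {measure set Z -> \bar R}) (S : Z -> Z).

(* Elements of L^1 and L^oo are represented by functions in [Lfun mu 1] and
   [Lfun mu +oo]; equality in these spaces is equality mu-almost everywhere. *)
Definition is_perron_frobenius (f g : Z -> R) : Prop :=
  g \in Lfun mu 1%E /\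
  forall h : Z -> R, h \in Lfun mu +oo%E ->
    (\int[mu]_z (h z * g z)%:E = \int[mu]_z (f z * h (S z))%:E)%E.

(* For S nonsingular and f in L^1(mu) such a g exists and is unique up to
   mu-null sets; the default value 0 is only taken outside this situation. *)
Definition perron_frobenius (f : Z -> R) : Z -> R :=
  xget (fun=> 0) [set g | is_perron_frobenius f g].

End perron_frobenius.

Section skew_perron_frobenius.
Context (d : measure_display) (R : realType) (X : measurableType d).
Variables (Y : ptopologicalType) (m : probability X R).
Variables (P : probability (borel (seq_space Y)) R) (T : Y -> X -> X).

(* The Perron-Frobenius operator of the skew product as an operator on L^1(m):
   L^1(m) sits in L^1(m x P) via f |-> f o fst, and this copy is mapped to
   itself. *)
Definition skew_perron_frobenius (f : X -> R) : X -> R :=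
  xget (fun=> 0) [set g : X -> R | g \in Lfun m 1%E /\
    g \o fst =
      perron_frobenius (m \x P)%E (skew_product T) (f \o fst)
      %[ae (m \x P)%E]].

End skew_perron_frobenius.

Section L1.
Context (d : measure_display) (R : realType) (X : measurableType d).
Variable m : {measure set X -> \bar R}.

Definition density (g : X -> R) : Prop :=
  [/\ g \in Lfun m 1%E,
      {ae m, forall x, 0 <= g x} &
      (\int[m]_x (g x)%:E = 1)%E].

(* Boundedness and linearity together make lam invariant under modification of
   its argument on a null set, so that lam is a functional on classes. *)
Definition bounded_linear_functional (lam : (X -> R) -> R) : Prop :=
  (forall (a : R) (f g : X -> R), f \in Lfun m 1%E -> g \in Lfun m 1%E ->
     lam (fun x => a * f x + g x) = a * lam f + lam g) /\
  exists C : R, forall f : X -> R, f \in Lfun m 1%E ->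
    (`|lam f|%:E <= C%:E * 'N[m]_1[EFin \o f])%E.

(* [L] is an operator on L^1(m) given on representatives.  [ordS] is the cyclic
   successor of 'I_(r i). *)
Definition asymptotically_periodic (L : (X -> R) -> X -> R) (s : nat)
    (r : 'I_s -> nat) (g : forall i : 'I_s, 'I_(r i) -> X -> R)
    (lam : forall i : 'I_s, 'I_(r i) -> (X -> R) -> R) : Prop :=
  ((0 < s)%N /\ forall i, (0 < r i)%N) /\
  (forall i j, density (g i j)) /\
  (forall i j, bounded_linear_functional (lam i j)) /\
  (forall (i k : 'I_s) (j : 'I_(r i)) (l : 'I_(r k)),
     (i : nat, j : nat) <> (k : nat, l : nat) ->
     (fun x => g i j x * g k l x) = (fun=> 0) %[ae m]) /\
  (forall (i : 'I_s) (j : 'I_(r i)), L (g i j) = g i (ordS j) %[ae m]) /\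
  (forall f : X -> R, f \in Lfun m 1%E ->
     ('N[m]_1[EFin \o iter n L (fun x =>
        (f x - \sum_(i < s) \sum_(j < r i) lam i j f * g i j x)%R)]
     @[n --> \oo] --> 0)%E).

End L1.

(* Main.v *)
(* Let E be the set of y with T_y = id.  If r(i) > 1 then f = g_{i,1} and
   L f = g_{i,2} have disjoint supports.  Test the duality defining L against
   h = 1_{f <> 0}: the left-hand side, the integral of h * L f, vanishes, whereas
   on {omega_1 in E} the skew product fixes x, so the right-hand side is at least
   eta(E) * (integral of f) = eta(E) > 0. *)
Require Import Defs.
From HB Require Import structures.
From mathcomp Require Import all_boot all_order all_algebra.
From mathcomp Require Import all_classical all_reals all_analysis.
From mathcomp Require Import measurable_realfun ess_sup_inf.

Set Implicit Arguments.
Unset Strict Implicit.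
Unset Printing Implicit Defensive.

Import Order.TTheory GRing.Theory Num.Theory.
Import numFieldTopology.Exports.

Local Open Scope classical_set_scope.
Local Open Scope ring_scope.

Lemma Lfun_measurable (d : measure_display) (R : realType)
  (Z : measurableType d) (mu : {measure set Z -> \bar R}) (p : \bar R)
  (f : Z -> R) :
  f \in Lfun mu p -> measurable_fun setT f.
Proof. by move/sub_Lfun_mfun; rewrite inE. Qed.

Lemma measurable_neq0 (d : measure_display) (R : realType)
  (Z : measurableType d) (f : Z -> R) :
  measurable_fun setT f -> measurable (f @^-1` [set~ 0]).
Proof.
by move=> mf; rewrite -[X in measurable X]setTI; apply: mf => //;
  exact: measurableC.
Qed.

Lemma Lfun_pinfty_indic (d : measure_display) (R : realType)
  (Z : measurableType d) (mu : {measure set Z -> \bar R}) (A : set Z) :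
  measurable A -> (\1_A : Z -> R) \in Lfun mu +oo%E.
Proof.
move=> mA; apply/andP; split; rewrite inE/=; first exact: measurable_indic.
(* The conditional in the norm of exponent [+oo] sets apart the case of zero total mass, where the
   norm is a finite default. Otherwise 1 is an essential bound. *)
rewrite /finite_norm unlock; case: ifP => [_|_]; last exact: ltry.
apply: (@le_lt_trans _ _ 1%E); last exact: ltry.
apply/ess_supP; apply: aeW => x /=.
by rewrite lee_fin indicE; case: (_ \in _); rewrite ?normr1 ?normr0.
Qed.

Lemma density_ae_neq0 (d : measure_display) (R : realType)
  (X : measurableType d) (m : {measure set X -> \bar R}) (g : X -> R) :
  density m g -> ~ (g = (fun=> 0) %[ae m]).
Proof.
move=> [gL _ intg] g0; have mg := Lfun_measurable gL.
move: intg; rewrite (@ae_eq_integral _ _ _ m setT (cst 0%E) (EFin \o g)) //.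
- by rewrite integral0 => /eqP; rewrite eqe eq_sym oner_eq0.
- exact/measurable_EFinP.
- by apply: filterS g0 => x /(_ I) /= ->.
Qed.

Section product_almost_everywhere.
Context (d1 d2 : measure_display) (R : realType).
Context (X : measurableType d1) (W : measurableType d2).
Variables (m : probability X R) (P : probability W R).

Lemma ae_product_fst (Q : X -> Prop) :
  {ae m, forall x, Q x} -> {ae (m \x P)%E, forall z, Q z.1}.
Proof.
move=> [N [mN N0 NQ]]; exists (N `*` setT); split.
- exact: measurableX.
- by rewrite product_measure1E//; move: N0 => /= ->; rewrite mul0e.
- by move=> z /= nQ; split => //; exact: NQ.
Qed.

(** The exceptional null set contains the rectangle of [f <> 0] and [E], whose measure is a product
    with positive factor [P E]; so the other factor is 0. *)
Lemma ae_fst_eq0 (f : X -> R) (E : set W) :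
  measurable_fun setT f -> measurable E -> (0 < P E)%E ->
  {ae (m \x P)%E, forall z, E z.2 -> f z.1 = 0} ->
  f = (fun=> 0) %[ae m].
Proof.
move=> mf mE PE0 [N [mN N0 NE]].
have mA := measurable_neq0 mf.
have : (m \x P)%E ((f @^-1` [set~ 0]) `*` E) = 0%E.
  apply: (subset_measure0 (measurableX mA mE) mN _ N0).
  by move=> z [/= fz Ez]; apply: NE => /= /(_ Ez).
rewrite product_measure1E// => /eqP.
rewrite mule_eq0 (gt_eqF PE0) orbF => /eqP mA0.
exists (f @^-1` [set~ 0]); split => //.
by move=> x /= fx fx0; apply: fx => _.
Qed.

End product_almost_everywhere.

(** Projections are continuous, and open sets generate the Borel field, so it suffices to pull back
    open sets. *)
Lemma measurable_coordinate (Y : ptopologicalType) (n : nat) :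
  measurable_fun setT (fun w : borel (seq_space Y) => w n : borel Y).
Proof.
apply: (@measurability _ _ _ _ _ _ (@open Y : set (set (borel Y))) erefl) => _ [B oB <-].
rewrite setTI; apply: sub_sigma_algebra.
have cn : continuous (fun w : seq_space Y => w n : Y).
  exact: (@proj_continuous nat (fun=> Y) n).
by apply: (open_comp (fun w _ => cn w) oB).
Qed.

Lemma product_measure_coordinate0 (R : realType) (Y : ptopologicalType)
  (eta : probability (borel Y) R) (P : probability (borel (seq_space Y)) R)
  (A : set (borel Y)) :
  is_product_measure eta P -> measurable A ->
  P [set w : borel (seq_space Y) | A (w 0%N)] = eta A.
Proof.
move=> prodP mA; have := prodP 1%N (fun=> A) (fun=> mA).
rewrite big_ord1 => <-; congr (P _); apply/seteqP; split => w /=.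
  by move=> Aw [|].
by apply.
Qed.

(* Once the value of the operator is not a.e. zero, neither [xget] has fallen
   back on its default, and the duality with L^oo holds. *)
Lemma skew_perron_frobenius_dual (d : measure_display) (R : realType)
  (X : measurableType d) (Y : ptopologicalType) (m : probability X R)
  (P : probability (borel (seq_space Y)) R) (T : Y -> X -> X) (f : X -> R) :
  ~ (skew_perron_frobenius m P T f = (fun=> 0) %[ae m]) ->
  skew_perron_frobenius m P T f \in Lfun m 1%E /\
  forall h, h \in Lfun (m \x P)%E +oo%E ->
  (\int[m \x P]_z (h z * skew_perron_frobenius m P T f z.1)%:E =
   \int[m \x P]_z (f z.1 * h (skew_product T z))%:E)%E.
Proof.
rewrite /skew_perron_frobenius.
case: xgetP => [g _ [gL]|_ /(_ (ae_eq_refl _ _ _))] //.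
have mg := Lfun_measurable gL.
rewrite /perron_frobenius; case: xgetP => [G _ [GL Gdual] gG _|_ g0 ng0].
  split=> // h hL; rewrite -(Gdual h hL).
  have mh := Lfun_measurable hL.
  have mG := Lfun_measurable GL.
  apply: ae_eq_integral => //.
  - apply/measurable_EFinP; apply: measurable_funM => //.
    exact: measurableT_comp.
  - by apply/measurable_EFinP; exact: measurable_funM.
  - by apply: filterS gG => z /(_ I) /= ->.
(* Here [perron_frobenius] takes its default 0, so [g \o fst] vanishes a.e. on the product. Choosing
   the whole sequence space, of mass 1, as [E] brings this down to [g], a contradiction. *)
exfalso; apply: ng0; apply: (@ae_fst_eq0 _ _ _ _ _ m P _ setT) => //.
by rewrite probability_setT.
Qed.

Lemma skew_perron_frobenius_meets_support (d : measure_display) (R : realType)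
  (X : measurableType d) (Y : ptopologicalType) (m : probability X R)
  (eta : probability (borel Y) R) (P : probability (borel (seq_space Y)) R)
  (T : Y -> X -> X) (f : X -> R) :
  is_product_measure eta P ->
  measurable_fun setT (fun z : X * borel Y => T z.2 z.1) ->
  measurable ([set y | T y = id] : set (borel Y)) ->
  (0 < eta [set y | T y = id])%E ->
  density m f ->
  ~ (skew_perron_frobenius m P T f = (fun=> 0) %[ae m]) ->
  ~ ((fun x => f x * skew_perron_frobenius m P T f x) = (fun=> 0) %[ae m]).
Proof.
move=> prodP mT mId Id0 df Lf0 disj.
have [fL f_ge0 _] := df.
have mf := Lfun_measurable fL.
pose A := f @^-1` [set~ 0].
have mA : measurable A by exact: measurable_neq0.
pose h : X * borel (seq_space Y) -> R := \1_(A `*` setT).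
have hE z : h z = \1_A z.1 by rewrite /h !indicE in_setX in_setT andbT.
have hL : h \in Lfun (m \x P)%E +oo%E.
  by apply: Lfun_pinfty_indic; exact: measurableX.
have [+ /(_ h hL)] := skew_perron_frobenius_dual Lf0.
move: disj {Lf0}; set Lf := skew_perron_frobenius m P T f => disj LfL.
have mLf := Lfun_measurable LfL.
have mh := Lfun_measurable hL.
(* Left side of the duality: [h] lives where [f <> 0], and there [Lf] vanishes a.e. by
   disjointness. *)
rewrite (@ae_eq_integral _ _ _ (m \x P)%E setT (cst 0%E)) //; first last.
- apply: filterS (ae_product_fst P disj) => z /(_ I)/= fLf0 _.
  rewrite hE indicE; case: (boolP (z.1 \in A)); last by rewrite mul0r.
  rewrite inE => fz; move/eqP: fLf0; rewrite mulf_eq0 => /orP[/eqP//|/eqP ->].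
  by rewrite mulr0.
- apply/measurable_EFinP; apply: measurable_funM => //.
  exact: measurableT_comp.
rewrite integral0 => /esym int0.
pose F (z : X * borel (seq_space Y)) := f z.1 * h (skew_product T z).
have mF : measurable_fun setT F.
  apply: measurable_funM; first exact: measurableT_comp.
  (* Since [h] ignores the sequence, [h \o skew_product T] factors through the point and the
     coordinate 0. Joint measurability of [T] then suffices, and the shift never enters. *)
  rewrite (_ : (fun z => h _) = \1_A \o (fun z : X * borel Y => T z.2 z.1)
    \o (fun z : X * borel (seq_space Y) => (z.1, z.2 0%N : borel Y))); last first.
    by apply/funext => z; rewrite hE.
  apply: measurableT_comp.
    by apply: measurableT_comp => //; exact: measurable_indic.
  apply: measurable_fun_pair => //.
  exact: measurableT_comp (measurable_coordinate 0) _.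
(* As [f] is a.e. nonnegative, so is [F]; its integral being 0, it vanishes a.e. *)
have F0 : F = (fun=> 0) %[ae (m \x P)%E].
  have mEF : measurable_fun setT (EFin \o F) by exact/measurable_EFinP.
  have /(ae_eq_integral_abs (m \x P)%E measurableT mEF) :
      (\int[m \x P]_z `|(EFin \o F) z|)%E = 0%E.
    rewrite -[RHS]int0; apply: ae_eq_integral => //.
    + exact: measurableT_comp.
    + apply: filterS (ae_product_fst P f_ge0) => z fz _ /=.
      by rewrite ger0_norm// mulr_ge0// hE indicE ler0n.
  by apply: filterS => z /(_ I)[].
apply: (density_ae_neq0 df).
(* Where [T (w 0)] is the identity, [F] reduces to [f] times the indicator of its own support, that
   is to [f]. So [f] would be a.e. zero, against its integral being 1. *)
apply: (@ae_fst_eq0 _ _ _ _ _ m P f [set w | T (w 0%N) = id]) => //.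
- rewrite -[X in measurable X]setTI.
  exact: (measurable_coordinate 0 measurableT mId).
- by rewrite (product_measure_coordinate0 (A := [set y | T y = id]) prodP).
- apply: filterS F0 => z /(_ I); rewrite /F hE /= => + Tz.
  rewrite Tz/= indicE; case: (boolP (z.1 \in A)); first by rewrite mulr1.
  by rewrite notin_setE => /contrapT.
Qed.

Theorem theorem2 (R : realType) (d : measure_display) (X : measurableType d)
  (m : probability X R)
  (Y : completeMetricType R) (sepY : separable Y)
  (eta : probability (borel Y) R)
  (P : probability (borel (seq_space Y)) R)
  (prodP : is_product_measure eta P)
  (T : Y -> X -> X)
  (nsT : forall y, nonsingular m (T y))
  (measT : measurable_fun setT (fun z : X * borel Y => T z.2 z.1))
  (s : nat) (r : 'I_s -> nat) (g : forall i : 'I_s, 'I_(r i) -> X -> R)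
  (lam : forall i : 'I_s, 'I_(r i) -> (X -> R) -> R)
  (apL : asymptotically_periodic m (skew_perron_frobenius m P T) g lam)
  (measId : measurable ([set y | T y = id] : set (borel Y)))
  (etaId : (0 < eta [set y | T y = id])%E) :
  forall i : 'I_s, r i = 1%N.
Proof.
move=> i; have [[_ /(_ i) ri0] [dg [_ [disj [Lg _]]]]] := apL.
apply/eqP; rewrite eqn_leq ri0 andbT leqNgt; apply/negP => ri1.
pose j := Ordinal ri0; have dj := dg i j.
have Lj := Lg i j; set j' := ordS j in Lj.
(* The image of [g i j] is a.e. the density [g i j'], hence not a.e. zero. *)
apply: (skew_perron_frobenius_meets_support prodP measT measId etaId dj).
  move=> Lj0; apply: (density_ae_neq0 (dg i j')).
  by apply: filterS2 Lj Lj0 => x /(_ I) <- /(_ I).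
(* The cyclic successor of 0 is 1 modulo [r i], which is 1 because [1 < r i]; the two indices
   therefore differ. *)
have := disj i i j j'; rewrite /j' /= modn_small// => /(_ _) disjj.
apply: filterS2 Lj (disjj _) => [x /(_ I) -> /(_ I)//|].
by case.
Qed.
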